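(* Let $n\ge 2$, let $z_1,\dots,z_n$ be distinct complex numbers, and let $a_1,\dots,a_n>0$ with $\sum_{i=1}^n a_i=1$. Let $w_1,\dots,w_{n-1}$ be the zeros, counted with multiplicity, of $f(z)=\sum_{i=1}^n\frac{a_i}{z-z_i}$. Put $\mathcal{Z}=\{z_1,\dots,z_n\}$, $\zeta=\sum_{i=1}^n a_iz_i$, $\mathcal{W}_e=\{w_1,\dots,w_{n-1},\zeta\}$, and $\sigma_2(\mathbf{z};\mathbf{a})=\big(\sum_{i=1}^n a_i|z_i-\zeta|^2\big)^{1/2}$. If $z_1,\dots,z_n$ are collinear, then $$H(\mathcal{Z},\mathcal{W}_e)\le\sigma_2(\mathbf{z};\mathbf{a}).$$
   Context: For non-empty sets $\Omega_1,\Omega_2\subset\mathbb{C}$, put $h(\Omega_1,\Omega_2)=\sup_{w\in\Omega_1}\inf_{z\in\Omega_2}|w-z|$; the (symmetrized) Hausdorff distance is $H(\Omega_1,\Omega_2)=\max\big(h(\Omega_1,\Omega_2),h(\Omega_2,\Omega_1)\big)$. *)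

(* Defs.v *)
From mathcomp Require Import all_boot all_order all_algebra.
From mathcomp Require Import generic_quotient fraction.
From mathcomp Require Import all_classical all_reals all_analysis.
From mathcomp Require Import complex.

Set Implicit Arguments.
Unset Strict Implicit.
Unset Printing Implicit Defensive.

Import Order.TTheory GRing.Theory Num.Theory.

Local Open Scope classical_set_scope.
Local Open Scope ring_scope.
Local Open Scope complex_scope.
Local Open Scope quotient_scope.

(* The norm of R[i] takes its values in R[i]; this is the R-valued modulus. *)
Definition modulus (R : realType) (x : R[i]) : R := ComplexField.Normc.normc x.

(* The supremum and infimum are taken in \bar R, so that unbounded sets do not
   produce the default values of sup and inf on R. *)
Definition hdist (R : realType) (A B : set R[i]) : \bar R :=
  ereal_sup [set ereal_inf [set (modulus (w - z))%:E | z in B] | w in A].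

Definition hausdorff (R : realType) (A B : set R[i]) : \bar R :=
  Order.max (hdist A B) (hdist B A).

Definition collinear (R : realType) (I : Type) (z : I -> R[i]) : Prop :=
  exists p d : R[i], d != 0 /\ forall i, exists t : R, z i = p + t%:C * d.

(* Multiplicity of x as a zero of the nonzero rational function f = p / q: the
   order of f at x, truncated to 0 at poles. It does not depend on the chosen
   representation (lemma zero_multE). *)
Definition zero_mult (F : fieldType) (f : {fraction {poly F}}) (x : F) : nat :=
  (mup x (frac (repr f)).1 - mup x (frac (repr f)).2)%N.

Definition zeros_with_mult (F : fieldType) (f : {fraction {poly F}})
    (m : nat) (w : 'I_m -> F) : Prop :=
  forall x : F, #|[pred k | w k == x]| = zero_mult f x.

Lemma zero_multE (F : fieldType) (p q : {poly F}) (x : F) :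
  p != 0 -> q != 0 ->
  zero_mult (FracField.tofrac p / FracField.tofrac q) x = (mup x p - mup x q)%N.
Proof.
move=> p0 q0; rewrite /zero_mult.
set f := _ / _.
set r := repr f.
have d0 : (frac r).2 != 0 by exact: denom_ratioP.
have e : p * (frac r).2 = q * (frac r).1.
  have fE : f = \pi_{fraction {poly F}} (Ratio p q).
    have tE (u : {poly F}) :
        FracField.tofrac u = \pi_(FracField.type {poly F}) (Ratio u 1).
      by rewrite piE.
    rewrite /f !tE.
    change (FracField.mul (\pi_(FracField.type {poly F}) (Ratio p 1))
      (FracField.inv (\pi_(FracField.type {poly F}) (Ratio q 1))) =
      \pi_(FracField.type {poly F}) (Ratio p q)).
    rewrite -FracField.pi_inv -FracField.pi_mul; congr (\pi_(_) _).
    by rewrite /FracField.mulf /FracField.invf !numden_Ratio ?oner_neq0 // mulr1 mul1r.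
  have := FracField.equivf_r (Ratio p q).
  by rewrite -fE -/r !numden_Ratio.
have n0 : (frac r).1 != 0.
  apply: contraNneq (mulf_neq0 p0 d0) => n0.
  by rewrite e n0 mulr0.
have := congr1 (mup x) e; rewrite !mupM // => em.
by rewrite -[RHS](subnDr (mup x (frac r).2)) em subnDl.
Qed.

Definition partial_fractions (R : realType) (n : nat) (a : 'I_n -> R)
    (z : 'I_n -> R[i]) : {fraction {poly R[i]}} :=
  \sum_(i < n) FracField.tofrac ((a i)%:C)%:P / FracField.tofrac ('X - (z i)%:P).

Definition barycenter (R : realType) (n : nat) (a : 'I_n -> R)
    (z : 'I_n -> R[i]) : R[i] :=
  \sum_(i < n) (a i)%:C * z i.

Definition sigma2 (R : realType) (n : nat) (a : 'I_n -> R)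
    (z : 'I_n -> R[i]) : R :=
  Num.sqrt (\sum_(i < n) a i * modulus (z i - barycenter a z) ^+ 2).

(* Main.v *)
Require Import Defs.
From mathcomp Require Import all_boot all_order all_algebra.
From mathcomp Require Import fraction.
From mathcomp Require Import all_classical all_reals all_analysis.
From mathcomp Require Import complex polyrcf ring lra.

Set Implicit Arguments.
Unset Strict Implicit.
Unset Printing Implicit Defensive.

Import Order.TTheory GRing.Theory Num.Theory.

Local Open Scope classical_set_scope.
Local Open Scope ring_scope.

(** An affine change of variable makes the poles real, [t_i], with mean [m] and
    variance [s^2] for the weights [a_i]; the zeros are then real too, and [m] is
    within [s] of some [t_i].
    By the symmetry [t -> - t], only one side of [m] needs treatment.
    Zeros: let [y <= m] be a zero and [c = m - y >= 0]. If [|t_i - y| > s] for all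
    [i], then [(t_i - m)^2 - s^2 + c s (2 s + c) / (t_i - y) > 0]; but the weighted
    mean of the left-hand side is 0.
    Poles: let [t_j = m + v] with [v >= s]. If some other pole lies in
    [[t_j - s, t_j)], there is a zero between the last such pole and [t_j].
    Otherwise [d_i = t_i - m] satisfies
    [(t_i - (t_j - s))^-1 <= (d_i^2 + s d_i - s v) / (v^2 s)] for all [i], whose
    weighted mean is [(s - v) / v^2 <= 0]; so [f (t_j - s) >= 0] while [f] tends
    to -oo at the left of [t_j]. *)

(** * Numerator of a partial fraction sum *)

(** Numerator of [\sum_i a i / (x - z i)] over the common denominator. Being defined at the poles
    too, it allows the intermediate value theorem on intervals that end at a pole. *)
Definition pf_numer (F : fieldType) (I : finType) (a z : I -> F) : {poly F} :=
  \sum_i (a i)%:P * \prod_(k | k != i) ('X - (z k)%:P).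

Lemma horner_pf_numer_pole (F : fieldType) (I : finType) (a z : I -> F) (i : I) :
  (pf_numer a z).[z i] = a i * \prod_(k | k != i) (z i - z k).
Proof.
rewrite /pf_numer horner_sum (bigD1 i) //= [X in _ + X]big1 ?addr0.
  rewrite hornerM hornerC horner_prod; congr (_ * _).
  by apply: eq_bigr => k _; rewrite hornerXsubC.
move=> j ji; rewrite hornerM horner_prod (bigD1 i) 1?eq_sym //=.
by rewrite hornerXsubC subrr mul0r mulr0.
Qed.

Lemma horner_pf_numer (F : fieldType) (I : finType) (a z : I -> F) (x : F) :
  (forall i, x != z i) ->
  (pf_numer a z).[x] = (\prod_k (x - z k)) * \sum_i a i / (x - z i).
Proof.
move=> xz; rewrite /pf_numer horner_sum mulr_sumr; apply: eq_bigr => i _.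
rewrite hornerM hornerC horner_prod [in RHS](bigD1 i) //=.
under eq_bigr do rewrite hornerXsubC.
by field; rewrite subr_eq0.
Qed.

(** At a pole the numerator is a product of nonzero factors, so no pole is a root; elsewhere it is a
    nonzero multiple of the sum. *)
Lemma root_pf_numer (F : fieldType) (I : finType) (a z : I -> F) (x : F) :
  injective z -> (forall i, a i != 0) ->
  root (pf_numer a z) x <->
  (forall i, x != z i) /\ \sum_i a i / (x - z i) = 0.
Proof.
move=> zI a0; split=> [/rootP px0|[xz s0]]; last first.
  by apply/rootP; rewrite horner_pf_numer // s0 mulr0.
have xz i : x != z i.
  apply/eqP => xE; move/eqP: px0; rewrite xE horner_pf_numer_pole.
  apply/negP; rewrite mulf_neq0 ?a0 //.
  by apply/prodf_neq0 => k ki; rewrite subr_eq0 (inj_eq zI) eq_sym.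
split=> //; move/eqP: px0; rewrite horner_pf_numer // mulf_eq0 => /orP[|/eqP//].
by move/prodf_eq0 => -[i _]; rewrite subr_eq0 (negPf (xz i)).
Qed.

(** Undoes the reflection of the poles used when a pole lies to the left of the mean; the sum merely
    changes sign. *)
Lemma pf_numer_root_opp (F : fieldType) (I : finType) (a z : I -> F) (x : F) :
  injective z -> (forall i, a i != 0) ->
  root (pf_numer a (fun i => - z i)) (- x) -> root (pf_numer a z) x.
Proof.
move=> zI a0 /root_pf_numer[|//|xz sE]; first by move=> i j /oppr_inj/zI.
apply/root_pf_numer => //; split=> [i|]; first by rewrite -eqr_opp.
apply: oppr_inj; rewrite oppr0 -[RHS]sE -sumrN; apply: eq_bigr => i _.
by rewrite -opprD invrN mulrN.
Qed.

(** * Real poles: a zero near each pole far from the mean *)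

(** The linear term averages to 0, so the mean only involves the variance; both key estimates rest
    on this. *)
Lemma sum_quadratic (R : realFieldType) (I : finType) (a t : I -> R) (m s p q r : R) :
  \sum_i a i = 1 -> \sum_i a i * t i = m ->
  \sum_i a i * (t i - m) ^+ 2 = s ^+ 2 ->
  \sum_i a i * (p * (t i - m) ^+ 2 + q * (t i - m) + r) = p * s ^+ 2 + r.
Proof.
move=> a1 am as2.
rewrite (eq_bigr (fun i => p * (a i * (t i - m) ^+ 2) +
  (q * (a i * t i) + (r - q * m) * a i))); last by move=> i _; ring.
rewrite !big_split /= -!mulr_sumr as2 am a1; ring.
Qed.

(* The bound is the quadratic polynomial in [d] interpolating [(d - v + s)^-1]
   at [v] and, to order two, at [-s]. *)
Lemma inv_le_quadratic (R : realFieldType) (d s v : R) : 0 < s -> 0 < v ->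
  d - v + s < 0 \/ v <= d ->
  (d - v + s)^-1 <= (v ^+ 2 * s)^-1 * (d ^+ 2 + s * d - s * v).
Proof.
move=> s0 v0 dP.
have u0 : d - v + s != 0 by case: dP => dP; lra.
rewrite -subr_ge0.
have -> : (v ^+ 2 * s)^-1 * (d ^+ 2 + s * d - s * v) - (d - v + s)^-1 =
   (v ^+ 2 * s)^-1 * (d + s) ^+ 2 * ((d - v) / (d - v + s)).
  by field; rewrite u0 !gt_eqF.
apply: mulr_ge0.
  by rewrite mulr_ge0 ?sqr_ge0 // invr_ge0 mulr_ge0 ?sqr_ge0 ?ltW.
case: dP => dP; last by rewrite divr_ge0 //; lra.
by rewrite -mulrNN -invrN divr_ge0 //; lra.
Qed.

Lemma sum_inv_le0 (R : realFieldType) (I : finType) (a t : I -> R) (m s v : R) :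
  (forall i, 0 < a i) -> \sum_i a i = 1 -> \sum_i a i * t i = m ->
  \sum_i a i * (t i - m) ^+ 2 = s ^+ 2 -> 0 < s -> s <= v ->
  (forall i, t i < m + v - s \/ m + v <= t i) ->
  0 <= \sum_i a i / (m + v - s - t i).
Proof.
move=> a0 a1 am as2 s0 sv tP; rewrite -oppr_le0 -sumrN.
have v0 : 0 < v by lra.
pose k := (v ^+ 2 * s)^-1.
apply: (@le_trans _ _ (\sum_i a i *
  (k * (t i - m) ^+ 2 + k * s * (t i - m) + k * (- (s * v))))).
  apply: ler_sum => i _; rewrite -mulrN ler_pM2l // -invrN.
  have -> : - (m + v - s - t i) = (t i - m) - v + s by ring.
  apply: le_trans (inv_le_quadratic s0 v0 _) _; last by rewrite /k; lra.
  by case: (tP i) => ?; [left|right]; lra.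
rewrite (sum_quadratic _ _ _ a1 am as2) -mulrDr mulr_ge0_le0 //.
  by rewrite invr_ge0 mulr_ge0 ?sqr_ge0 ?ltW.
by rewrite expr2 -mulrBr mulr_ge0_le0; lra.
Qed.

Lemma exists_root_between (R : rcfType) (I : finType) (a t : I -> R) (i j : I) :
  (forall k, 0 < a k) -> t i < t j ->
  (forall k, t k <= t i \/ t j <= t k) ->
  exists2 x, t i <= x <= t j & root (pf_numer a t) x.
Proof.
move=> a0 ij sep.
have [||x] := @polyrcf.poly_ivt _ (pf_numer a t) (t i) (t j); first exact: ltW.
  have nij : i != j by apply: contraTneq ij => ->; rewrite ltxx.
  rewrite !horner_pf_numer_pole.
  rewrite [\prod_(k | k != i) _](bigD1 j) 1?eq_sym //=.
  rewrite [\prod_(k | k != j) _](bigD1 i) //=.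
  under eq_bigl do rewrite andbC.
  (* The two factors singled out multiply to [- (t j - t i) ^+ 2]. Every other pole is on the same
     side of both endpoints, so the remaining factors pair up to nonnegative products. *)
  rewrite [X in X <= _](_ : _ = - (a i * a j * (t j - t i) ^+ 2 *
     \prod_(k | (k != j) && (k != i)) ((t i - t k) * (t j - t k)))).
    rewrite oppr_le0; apply: mulr_ge0.
      by rewrite mulr_ge0 ?sqr_ge0 // mulr_ge0 // ltW.
    apply: prodr_ge0 => k _; case: (sep k) => tk.
      by rewrite mulr_ge0; lra.
    by rewrite -mulrNN mulr_ge0; lra.
  by rewrite big_split /=; ring.
by rewrite in_itv /= => xP rx; exists x.
Qed.

(** The factor [y - t j] of the common denominator gives the numerator weakly opposite signs at [y]
    and [t j]; this replaces the limit -oo of the sum at the left of [t j]. *)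
Lemma exists_root_left (R : rcfType) (I : finType) (a t : I -> R) (j : I) (y : R) :
  (forall k, 0 < a k) -> y < t j ->
  (forall k, t k < y \/ t j <= t k) -> 0 <= \sum_k a k / (y - t k) ->
  exists2 x, y <= x <= t j & root (pf_numer a t) x.
Proof.
move=> a0 yj sep sum0.
have [||x] := @polyrcf.poly_ivt _ (pf_numer a t) y (t j); first exact: ltW.
  rewrite horner_pf_numer => [|k]; last by case: (sep k) => ?; apply/eqP; lra.
  rewrite horner_pf_numer_pole (bigD1 j) //=.
  rewrite [X in X <= _](_ : _ = - (a j * (t j - y) * (\sum_k a k / (y - t k)) *
     \prod_(k | (k != j)) ((y - t k) * (t j - t k)))).
    rewrite oppr_le0; apply: mulr_ge0.
      by rewrite mulr_ge0 // mulr_ge0 ?(ltW (a0 j)) ?subr_ge0 // ltW.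
    apply: prodr_ge0 => k _; case: (sep k) => tk.
      by rewrite mulr_ge0; lra.
    by rewrite -mulrNN mulr_ge0; lra.
  by rewrite big_split /=; ring.
by rewrite in_itv /= => xP rx; exists x.
Qed.

Lemma root_near_right_pole (R : rcfType) (I : finType) (a t : I -> R) (m s : R) (j : I) :
  (forall i, 0 < a i) -> \sum_i a i = 1 -> \sum_i a i * t i = m ->
  \sum_i a i * (t i - m) ^+ 2 = s ^+ 2 -> 0 < s -> s <= t j - m ->
  exists2 x, root (pf_numer a t) x & `|t j - x| <= s.
Proof.
move=> a0 a1 am as2 s0 sj.
have [sep|] := pselect (forall i, t i < t j - s \/ t j <= t i).
  have [|i||x xP rx] := @exists_root_left _ _ a t j (t j - s) a0; first by lra.
  - exact: sep.
  - have -> : t j - s = m + (t j - m) - s by ring.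
    by apply: sum_inv_le0 => // i; case: (sep i) => ?; [left|right]; lra.
  - by exists x => //; rewrite ger0_norm; lra.
move=> /existsNP[i0 /not_orP[/negP i0l /negP i0r]].
rewrite -leNgt in i0l; rewrite -ltNge in i0r.
(* [i] is the last pole before [t j]. As [t i >= t i0 >= t j - s], a zero between [t i] and [t j] is
   within [s] of [t j]. *)
case: (@arg_maxP _ _ _ i0 (fun i => t i < t j) t i0r) => i ij imax.
have [k|x xP rx] := exists_root_between a0 ij.
  by case: (ltP (t k) (t j)) => ?; [left; exact: imax|right].
have ii0 : t i0 <= t i by exact: imax.
by exists x => //; rewrite ger0_norm; lra.
Qed.

Lemma root_near_pole (R : rcfType) (I : finType) (a t : I -> R) (m s : R) (j : I) :
  injective t ->
  (forall i, 0 < a i) -> \sum_i a i = 1 -> \sum_i a i * t i = m ->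
  \sum_i a i * (t i - m) ^+ 2 = s ^+ 2 -> 0 < s -> s <= `|t j - m| ->
  exists2 x, root (pf_numer a t) x & `|t j - x| <= s.
Proof.
move=> tI a0 a1 am as2 s0; case: (ger0P (t j - m)) => _ sj.
  exact: (@root_near_right_pole _ _ a t m).
have [||||x rx xP] := @root_near_right_pole _ _ a (fun i => - t i) (- m) s j a0 a1.
- by rewrite -am -sumrN; apply: eq_bigr => i _; rewrite mulrN.
- by rewrite -as2; apply: eq_bigr => i _; ring.
- exact: s0.
- by lra.
exists (- x); first by apply: pf_numer_root_opp; rewrite ?opprK // => i; rewrite gt_eqF.
by rewrite (_ : _ - - x = - (- t j - x)) ?normrN //; ring.
Qed.

(** * Real poles: a pole near each zero and near the mean *)

(* The coefficient of [u^-1] makes the numerator [u * ((u - c)^2 - s^2) + ...]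
   divisible by [u + s]. *)
Lemma sqr_sub_inv_gt0 (R : realFieldType) (c s u : R) : 0 <= c -> 0 < s -> s < `|u| ->
  0 < (u - c) ^+ 2 - s ^+ 2 + c * s * (s *+ 2 + c) / u.
Proof.
move=> c0 s0 su.
have u0 : u != 0 by apply: contraTneq su => ->; rewrite normr0; lra.
have -> : (u - c) ^+ 2 - s ^+ 2 + c * s * (s *+ 2 + c) / u =
  ((u - s - c) ^+ 2 + s * (u - s)) * ((u + s) / u) by field.
case: (ltP 0 u) su => [up|un]; [rewrite gtr0_norm // | rewrite ler0_norm //] => su.
  by rewrite mulr_gt0 ?divr_gt0 ?ltr_wpDl ?sqr_ge0 ?mulr_gt0 //; lra.
rewrite mulr_gt0 //.
  (* For negative [u] the term [s * (u - s)] is negative; it is absorbed using [(s - u) ^+ 2 - s *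
     (s - u) = (s - u) * - u]. *)
  have -> : (u - s - c) ^+ 2 + s * (u - s) =
    (s - u) * - u + c * (c + (s - u) *+ 2) by ring.
  by rewrite ltr_pwDl ?mulr_gt0 ?mulr_ge0 //; lra.
by rewrite -mulrNN -invrN divr_gt0; lra.
Qed.

(** If every value exceeded the mean, the deviations from it would be positive with weighted sum
    0. *)
Lemma le_weighted_mean (R : realFieldType) (I : finType) (a f : I -> R) :
  (forall i, 0 < a i) -> \sum_i a i = 1 ->
  exists i, f i <= \sum_k a k * f k.
Proof.
move=> a0 a1; set mu := \sum_k _.
have [//|/forallNP fP] := pselect (exists i, f i <= mu).
have fmu i : mu < f i by rewrite ltNge; apply/negP/fP.
have s0 : \sum_i a i * (f i - mu) = 0.
  under eq_bigr do rewrite mulrBr.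
  by rewrite sumrB -mulr_suml a1 mul1r subrr.
(* Weights of sum 1 rule out an empty index type. *)
have [i _|I0] := pickP (@predT I); last first.
  by move: a1; rewrite big_pred0 // => /eqP; rewrite eq_sym oner_eq0.
have /psumr_eq0P/(_ s0 i isT)/eqP : forall k, true -> 0 <= a k * (f k - mu).
  by move=> k _; rewrite mulr_ge0 ?subr_ge0 // ltW.
by rewrite mulf_eq0 gt_eqF //= subr_eq0 gt_eqF.
Qed.

Lemma pole_near_left_root (R : realFieldType) (I : finType) (a t : I -> R) (m s y : R) :
  (forall i, 0 < a i) -> \sum_i a i = 1 -> \sum_i a i * t i = m ->
  \sum_i a i * (t i - m) ^+ 2 = s ^+ 2 -> 0 < s -> y <= m ->
  \sum_i a i / (y - t i) = 0 ->
  exists i, `|y - t i| <= s.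
Proof.
move=> a0 a1 am as2 s0 ym y0.
pose c := m - y.
have [i iP] := le_weighted_mean (fun i => (t i - y - c) ^+ 2 - s ^+ 2 +
  c * s * (s *+ 2 + c) / (t i - y)) a0 a1.
exists i; rewrite leNgt; apply/negP; rewrite distrC.
have c0 : 0 <= c by rewrite subr_ge0.
move/(sqr_sub_inv_gt0 c0 s0); rewrite ltNge; move/negP; apply.
apply: le_trans iP _.
(* Since [t i - y - c = t i - m], the quadratic part has mean [s ^+ 2 - s ^+ 2]; the reciprocals
   average to 0 because [y] is a zero. *)
rewrite (eq_bigr (fun i => a i * (1 * (t i - m) ^+ 2 + 0 * (t i - m) + - s ^+ 2)
   - c * s * (s *+ 2 + c) * (a i / (y - t i)))); last first.
  by move=> k _; rewrite -[y - t k]opprB invrN /c; ring.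
rewrite sumrB -mulr_sumr y0 (sum_quadratic _ _ _ a1 am as2); lra.
Qed.

Lemma pole_near_root (R : realFieldType) (I : finType) (a t : I -> R) (m s y : R) :
  (forall i, 0 < a i) -> \sum_i a i = 1 -> \sum_i a i * t i = m ->
  \sum_i a i * (t i - m) ^+ 2 = s ^+ 2 -> 0 < s ->
  \sum_i a i / (y - t i) = 0 ->
  exists i, `|y - t i| <= s.
Proof.
move=> a0 a1 am as2 s0 y0; case: (leP y m) => ym.
  exact: (@pole_near_left_root _ _ a t m).
have [|||||i iP] :=
    @pole_near_left_root _ _ a (fun i => - t i) (- m) s (- y) a0 a1.
- by rewrite -am -sumrN; apply: eq_bigr => i _; rewrite mulrN.
- by rewrite -as2; apply: eq_bigr => i _; ring.
- exact: s0.
- by rewrite lerN2 ltW.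
- apply: oppr_inj; rewrite oppr0 -[RHS]y0 -sumrN; apply: eq_bigr => i _.
  by rewrite -opprD invrN mulrN opprK.
by exists i; rewrite -normrN opprD.
Qed.

Lemma pole_near_mean (R : realFieldType) (I : finType) (a t : I -> R) (m s : R) :
  (forall i, 0 < a i) -> \sum_i a i = 1 ->
  \sum_i a i * (t i - m) ^+ 2 = s ^+ 2 -> 0 <= s ->
  exists i, `|m - t i| <= s.
Proof.
move=> a0 a1 as2 s0.
have [i +] := le_weighted_mean (fun i => (t i - m) ^+ 2) a0 a1.
rewrite as2 /= => mi; exists i.
by rewrite distrC -ler_sqr -?topredE //= ?normr_ge0 // real_normK ?num_real //.

Qed.

(** * Transfer from the real line to a complex line *)

Local Open Scope complex_scope.

(** For [y != 0], the sum at [x + iy] has imaginary part [- y] times a weighted mean of the positive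
    numbers [((x - t i) ^+ 2 + y ^+ 2)^-1], hence is not 0. *)
Lemma real_zero_pf (R : rcfType) (I : finType) (a t : I -> R) (x : R[i]) :
  (forall i, 0 < a i) -> \sum_i a i = 1 ->
  \sum_i (a i)%:C / (x - (t i)%:C) = 0 -> complex.Im x = 0.
Proof.
case: x => x y a0 a1 /(congr1 (@complex.Im R)) /=.
rewrite (big_morph (@complex.Im R) (id1 := 0) (op1 := +%R)); [|by case=> ? ? []|by []].
rewrite (eq_bigr (fun i => - y * (a i * ((x - t i) ^+ 2 + y ^+ 2)^-1))); last first.
  by move=> i _ /=; rewrite oppr0 addr0 mul0r; ring.
rewrite -mulr_sumr => /eqP; rewrite mulf_eq0 oppr_eq0 => /orP[/eqP//|/eqP s0].
apply/eqP; apply: contraT => y0.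
have [i +] := le_weighted_mean (fun i => ((x - t i) ^+ 2 + y ^+ 2)^-1) a0 a1.
rewrite s0 invr_le0 leNgt ltr_wpDl ?sqr_ge0 // exprn_even_gt0 //.
Qed.

Lemma pf_sum_affine (R : rcfType) (I : finType) (a t : I -> R) (p d x : R[i]) :
  \sum_i (a i)%:C / (p + x * d - (p + (t i)%:C * d)) =
  (\sum_i (a i)%:C / (x - (t i)%:C)) / d.
Proof.
rewrite mulr_suml; apply: eq_bigr => i _.
by rewrite opprD addrACA subrr add0r -mulrBl invfM mulrA.
Qed.

Lemma root_pf_numer_affine (R : rcfType) (I : finType) (a t : I -> R) (p d x : R[i]) :
  injective t -> (forall i, 0 < a i) -> \sum_i a i = 1 -> d != 0 ->
  root (pf_numer (fun i => (a i)%:C) (fun i => p + (t i)%:C * d)) x <->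
  exists2 y, root (pf_numer a t) y & x = p + y%:C * d.
Proof.
move=> tI a0 a1 d0.
have tC (y : R) : \sum_i (a i)%:C / (y%:C - (t i)%:C) = (\sum_i a i / (y - t i))%:C.
  by rewrite rmorph_sum /=; apply: eq_bigr => i _; rewrite fmorph_div rmorphB.
have zI : injective (fun i => p + (t i)%:C * d).
  by move=> i j /addrI/(mulIf d0)/complexI/tI.
have aC0 i : (a i)%:C != 0 by rewrite fmorph_eq0 gt_eqF.
have an0 i : a i != 0 by rewrite gt_eqF.
split=> [/(root_pf_numer _ zI aC0)[+ +]|[y /(root_pf_numer _ tI an0)[yt y0] ->]].
  (* The coordinate [y] of [x] along the line is at first complex; [real_zero_pf] then makes it
     real. *)
  have [y ->] : exists y, x = p + y * d by exists ((x - p) / d); field.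
  move=> xz.
  rewrite pf_sum_affine => /eqP.
  rewrite mulf_eq0 invr_eq0 (negPf d0) orbF => /eqP.
  case: y xz => y v xz y0.
  have /= v0 := real_zero_pf a0 a1 y0; move: xz y0; rewrite v0 complexr0 => xz.
  rewrite tC => /complexI y0; exists y => //; apply/root_pf_numer => //.
  by split=> // i; apply: contraNneq (xz i) => ->.
apply/root_pf_numer => //; split=> [i|]; last by rewrite pf_sum_affine tC y0 mul0r.
by apply: contraNneq (yt i) => /addrI/(mulIf d0)/complexI ->.
Qed.

Local Close Scope complex_scope.

(** * Zeros of the rational function *)

(** [i] excludes the empty index type, where the numerator is the empty sum 0. *)
Lemma pf_numer_neq0 (F : fieldType) (I : finType) (a z : I -> F) (i : I) :
  injective z -> (forall i, a i != 0) -> pf_numer a z != 0.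
Proof.
move=> zI a0; apply: contraTneq isT => p0.
have : root (pf_numer a z) (z i) by rewrite p0 root0.
by move=> /root_pf_numer[//|//|/(_ i)]; rewrite eqxx.
Qed.

Lemma partial_fractions_quotient (R : realType) (n : nat) (a : 'I_n -> R)
    (z : 'I_n -> R[i]) :
  partial_fractions a z =
  FracField.tofrac (pf_numer (fun i => (a i)%:C%C) z) /
  FracField.tofrac (\prod_i ('X - (z i)%:P)).
Proof.
rewrite /partial_fractions /pf_numer rmorph_sum mulr_suml; apply: eq_bigr => i _.
rewrite [\prod_(k | true) _](bigD1 i) //= !tofracM.
rewrite -mulf_div divff ?mulr1 // tofrac_eq0.
by apply/prodf_neq0 => k _; rewrite polyXsubC_eq0.
Qed.

(** No root of the numerator is a pole, so the denominator lowers no multiplicity. Only the set of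
    zeros is kept, which is all that the Hausdorff distance sees. *)
Lemma zeros_partial_fractions (R : realType) (n m : nat) (a : 'I_n -> R)
    (z : 'I_n -> R[i]) (w : 'I_m -> R[i]) (x : R[i]) :
  (0 < n)%N -> injective z -> (forall i, 0 < a i) ->
  zeros_with_mult (partial_fractions a z) w ->
  (exists k, w k = x) <-> root (pf_numer (fun i => (a i)%:C%C) z) x.
Proof.
move=> n0 zI a0 wz; set P := pf_numer _ z; pose Q := \prod_i ('X - (z i)%:P).
have aC0 i : (a i)%:C%C != 0 :> R[i] by rewrite fmorph_eq0 gt_eqF.
have P0 : P != 0 by exact: (pf_numer_neq0 (Ordinal n0)).
have Q0 : Q != 0 by apply/prodf_neq0 => k _; rewrite polyXsubC_eq0.
have -> : (exists k, w k = x) <-> (0 < mup x P - mup x Q)%N.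
  rewrite -zero_multE // -partial_fractions_quotient -wz.
  by split=> [[k <-]|/card_gt0P[k /eqP]]; [apply/card_gt0P; exists k; exact/eqP|exists k].
have [Px|Px] := boolP (root P x); last by rewrite (mupNroot Px).
rewrite (@mupNroot _ x Q) ?subn0; first by rewrite -XsubC_dvd // dvdp_XsubCl.
have [xz _] := (root_pf_numer x zI aC0).1 Px.
apply/negP => /rootP; rewrite horner_prod => /eqP/prodf_eq0[i _].
by rewrite hornerXsubC subr_eq0 (negPf (xz i)).
Qed.

(** * Modulus and Hausdorff distance *)

Lemma modulusM (R : realType) (x y : R[i]) : modulus (x * y) = modulus x * modulus y.
Proof. exact: ComplexField.Normc.normcM. Qed.

Lemma modulus_real (R : realType) (x : R) : modulus x%:C%C = `|x|.
Proof. by rewrite /modulus /= expr0n addr0 sqrtr_sqr. Qed.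

Lemma modulus_ge0 (R : realType) (x : R[i]) : 0 <= modulus x.
Proof. by case: x => x y; exact: sqrtr_ge0. Qed.

Lemma modulus_affineB (R : realType) (p d : R[i]) (x y : R) :
  modulus (p + x%:C%C * d - (p + y%:C%C * d)) = `|x - y| * modulus d.
Proof.
by rewrite opprD addrACA subrr add0r -mulrBl -rmorphB modulusM modulus_real.
Qed.

Lemma hdist_le (R : realType) (A B : set R[i]) (r : R) :
  (forall x, A x -> exists2 y, B y & modulus (x - y) <= r) ->
  (hdist A B <= r%:E)%E.
Proof.
move=> AB; apply: ge_ereal_sup => _ [x Ax <-].
have [y By xy] := AB x Ax.
by apply: (@le_trans _ _ (modulus (x - y))%:E); [apply: ereal_inf_lbound; exists y|].
Qed.

Theorem theorem5 (R : realType) (n : nat) (z : 'I_n -> R[i]) (a : 'I_n -> R)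
    (w : 'I_n.-1 -> R[i])
    (n_ge2 : (2 <= n)%N)
    (z_distinct : injective z)
    (a_gt0 : forall i, 0 < a i)
    (a_sum1 : \sum_(i < n) a i = 1)
    (w_zeros : zeros_with_mult (partial_fractions a z) w)
    (z_collinear : collinear z) :
  (hausdorff (range z) (range w `|` [set barycenter a z]) <= (sigma2 a z)%:E)%E.
Proof.
have n_gt0 : (0 < n)%N by exact: ltnW.
have wE x := zeros_partial_fractions x n_gt0 z_distinct a_gt0 w_zeros.
have [p [d [d0 /choice[t zt]]]] := z_collinear.
have {zt} zE : z = fun i => p + (t i)%:C%C * d by exact/funext.
have tI : injective t.
  by move=> i j tij; apply: z_distinct; rewrite zE /= tij.
rewrite zE in wE *.
pose m := \sum_i a i * t i.
pose s := Num.sqrt (\sum_i a i * (t i - m) ^+ 2).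
have v0 : 0 <= \sum_i a i * (t i - m) ^+ 2.
  by apply: sumr_ge0 => i _; rewrite mulr_ge0 ?sqr_ge0 // ltW.
have as2 : \sum_i a i * (t i - m) ^+ 2 = s ^+ 2 by rewrite sqr_sqrtr.
(* A zero variance would make all [t i] equal, whereas [n >= 2] supplies the two indices 0 and 1. *)
have s_gt0 : 0 < s.
  rewrite sqrtr_gt0 lt_neqAle v0 andbT eq_sym; apply/eqP => /psumr_eq0P tm.
  have {}tm i : t i = m.
    have /eqP := tm (fun i _ => mulr_ge0 (ltW (a_gt0 i)) (sqr_ge0 _)) i isT.
    by rewrite mulf_eq0 gt_eqF //= sqrf_eq0 subr_eq0 => /eqP.
  have /tI/(congr1 val) // : t (Ordinal n_gt0) = t (Ordinal n_ge2) by rewrite !tm.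
have bE : barycenter a (fun i => p + (t i)%:C%C * d) = p + m%:C%C * d.
  rewrite /barycenter rmorph_sum mulr_suml.
  under eq_bigr do rewrite mulrDr mulrA -rmorphM.
  by rewrite big_split /= -mulr_suml -rmorph_sum a_sum1 mul1r.
(* [sigma2] scales by [modulus d] like all distances along the line, so the real estimates
   suffice. *)
have sE : sigma2 a (fun i => p + (t i)%:C%C * d) = s * modulus d.
  rewrite /sigma2 bE.
  under eq_bigr do rewrite modulus_affineB exprMn real_normK ?num_real // mulrA.
  by rewrite -mulr_suml sqrtrM // sqrtr_sqr (ger0_norm (modulus_ge0 d)).
rewrite sE bE /hausdorff ge_max; apply/andP; split; apply: hdist_le.
  move=> _ [j _ <-].
  (* A pole within [s] of the mean is matched with the barycenter, any other with a zero. *)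
  have [tm|/ltW tm] := leP `|t j - m| s.
    exists (p + m%:C%C * d); first by right.
    by rewrite modulus_affineB ler_wpM2r ?modulus_ge0.
  have [x rx xP] := root_near_pole tI a_gt0 a_sum1 erefl as2 s_gt0 tm.
  exists (p + x%:C%C * d); last by rewrite modulus_affineB ler_wpM2r ?modulus_ge0.
  left; have [k kP] : exists k, w k = p + x%:C%C * d.
    by apply/wE/root_pf_numer_affine => //; exists x.
  by exists k.
move=> _ [[k _ <-]|->].
  have /wE/root_pf_numer_affine : exists l, w l = w k by exists k.
  move=> /(_ tI a_gt0 a_sum1 d0)[y /root_pf_numer yP ->].
  have [//|i|_ y0] := yP; first by rewrite gt_eqF.
  have [i iP] := pole_near_root a_gt0 a_sum1 erefl as2 s_gt0 y0.
  exists (p + (t i)%:C%C * d); first by exists i.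
  by rewrite modulus_affineB ler_wpM2r ?modulus_ge0.
have [i iP] := pole_near_mean a_gt0 a_sum1 as2 (ltW s_gt0).
exists (p + (t i)%:C%C * d); first by exists i.
by rewrite modulus_affineB ler_wpM2r ?modulus_ge0.
Qed.
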